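(* Let $\Gamma$ be a finite connected quiver. The following properties are equivalent: (i) all $P(\Gamma)$-Systems in $P(\Gamma)\text{-}\mathcal{TOP}^{o}$ are positively graded; (ii) any cycle in $\Gamma$ is symmetric; (iii) there exists an arrow positive function on $\Gamma$; (iv) all $P(\Gamma)$-Systems in $P(\Gamma)\text{-}\mathcal{TOP}^{o}$ are vertex positively graded.
   Context: A quiver $\Gamma=(\Gamma_0,\Gamma_1)$ is an oriented graph with vertex set $\Gamma_0$, arrow set $\Gamma_1$, source and target maps $s,t:\Gamma_1\to\Gamma_0$; it is finite if both sets are finite, and connected if its underlying unoriented graph is connected. $P(\Gamma)$ is the semigroup with zero consisting of $0$ and all paths of $\Gamma$ (including the trivial paths $e_i$, $i\in\Gamma_0$); the product $\rho\rho'$ of paths is their concatenation (first $\rho'$, then $\rho$) if the source of $\rho$ equals the target of $\rho'$, and $0$ otherwise; $0$ is absorbing. A $P(\Gamma)$-System is a nonempty topological space $M$ with an action $(\rho,m)\mapsto\rho m$ of $P(\Gamma)$ such that $(\rho\rho')m=\rho(\rho'm)$ and each map $m\mapsto\rho m$ is continuous. It belongs to $P(\Gamma)\text{-}\mathcal{TOP}^{o}$ if: (a) $P(\Gamma)M=M$; (b) there is a unique $\theta_M\in M$ such that $\{\theta_M\}$ is a connected component of $M$ which is an isolated point and $0m=\theta_M$ for all $m\in M$; (c) if $e_im\neq\theta_M$ then $\alpha m\neq\theta_M$ for every arrow $\alpha$ starting at $i$. $P(\Gamma)$ carries its natural positive gradation $P(\Gamma)=\bigcup_{i\ge0}P(\Gamma)_{(i)}$,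 where $P(\Gamma)_{(i)}$ consists of $0$ and all paths of length $i$. An object $M$ is positively graded if there is a family of nonempty subsets $\{M_{(i)}\}_{i\geq0}$ (the homogeneous components) with $M=\bigcup_{i\ge0}M_{(i)}$, $P(\Gamma)_{(i)}M_{(j)}\subseteq M_{(i+j)}$ for all $i,j\ge 0$, and $M_{(i)}\cap M_{(j)}=\{\theta_M\}$ for $i\ne j$. It is vertex positively graded if it has such a positive gradation in which, for every vertex $v\in\Gamma_0$, the set $e_vM$ is contained in some homogeneous component. A cycle in $\Gamma$ is a sub-quiver whose underlying unoriented graph is a closed (simple) cycle (loops and pairs of arrows joining the same two vertices are included). A cycle is symmetric if its number of clockwise arrows equals its number of anti-clockwise arrows. An arrow positive function on $\Gamma$ is a function $F:\Gamma_0\to\mathbb{Z}_{\ge0}$ with $F(t(\alpha))=F(s(\alpha))+1$ for every arrow $\alpha\in\Gamma_1$. *)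

(* Defs.v *)
From HB Require Import structures.
From mathcomp Require Import all_boot.
From mathcomp Require Import classical_sets topology.

Set Implicit Arguments.
Unset Strict Implicit.
Unset Printing Implicit Defensive.

Local Open Scope classical_set_scope.

Record finQuiver := FinQuiver {
  vertex : finType;
  arrow : finType;
  src : arrow -> vertex;
  tgt : arrow -> vertex }.

Section Quiver.
Variable Q : finQuiver.
Local Notation V := (vertex Q).
Local Notation A := (arrow Q).

Definition adjacent : rel V := fun x y =>
  [exists a : A, ((src a == x) && (tgt a == y)) || ((src a == y) && (tgt a == x))].

Definition connected_quiver : Prop := forall x y : V, connect adjacent x y.

Definition arrow_positive (F : V -> nat) : Prop :=
  forall a : A, F (tgt a) = (F (src a) + 1)%N.

(* A path is a starting vertex together with its arrows in the order in which  *)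
(* they are traversed; the trivial path e_v is (v, [::]).                      *)
Fixpoint walk (v : V) (l : seq A) : bool :=
  if l is a :: l' then (src a == v) && walk (tgt a) l' else true.

Definition walk_end (v : V) (l : seq A) : V := last v (map (@tgt Q) l).

Definition qpath := {p : V * seq A | walk p.1 p.2}.
Definition psrc (r : qpath) : V := (val r).1.
Definition parr (r : qpath) : seq A := (val r).2.
Definition ptgt (r : qpath) : V := walk_end (psrc r) (parr r).
Definition plen (r : qpath) : nat := size (parr r).

Definition trivial_path (v : V) : qpath := exist _ (v, [::]) isT.

Lemma arrow_pathP (a : A) : walk (src a) [:: a].
Proof. by rewrite /= eqxx. Qed.

Definition arrow_path (a : A) : qpath := exist _ (src a, [:: a]) (arrow_pathP a).

Lemma walk_cat v l1 l2 :
  walk v (l1 ++ l2) = walk v l1 && walk (walk_end v l1) l2.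
Proof. by elim: l1 v => //= a l1 IH v; rewrite IH andbA. Qed.

Lemma walk_end_cat v l1 l2 :
  walk_end v (l1 ++ l2) = walk_end (walk_end v l1) l2.
Proof. by rewrite /walk_end map_cat last_cat. Qed.

Lemma concatP (r r' : qpath) : psrc r = ptgt r' ->
  walk (psrc r') (parr r' ++ parr r).
Proof. by move=> e; rewrite walk_cat (valP r') -/(ptgt r') -e (valP r). Qed.

(* First r', then r. *)
Definition concat (r r' : qpath) (e : psrc r = ptgt r') : qpath :=
  exist _ (psrc r', parr r' ++ parr r) (concatP e).

(* The semigroup with zero P(Q): None is the zero, Some r the path r. *)
Definition path_sgrp := option qpath.

Definition pzero : path_sgrp := None.

Definition pmul (x y : path_sgrp) : path_sgrp :=
  match x, y with
  | Some r, Some r' =>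
      if psrc r =P ptgt r' is ReflectT e then Some (concat e) else pzero
  | _, _ => pzero
  end.

Lemma pmulA : associative pmul.
Proof.
pose code : path_sgrp -> option (V * seq A) := omap val.
pose m (x y : option (V * seq A)) := match x, y with
  | Some p, Some q => if p.1 == walk_end q.1 q.2 then Some (q.1, q.2 ++ p.2)
                      else None
  | _, _ => None end.
have codeI : injective code by apply/inj_omap/val_inj.
have codeM x y : code (pmul x y) = m (code x) (code y).
  case: x y => [r|] [r'|] //=; rewrite -/(psrc r) -/(psrc r') -/(parr r') -/(ptgt r').
  by case: (psrc r =P ptgt r').
move=> x y z; apply: codeI; rewrite !codeM.
case: (code x) (code y) (code z) => [[u k]|] [[v l]|] [[w n]|] //=;
  try by case: ifP.
case: (v =P _) => [->|nv] /=; last by case: ifP => //= _; case: eqP.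
by rewrite walk_end_cat; case: ifP => //= _; rewrite eqxx catA.
Qed.

HB.instance Definition _ := Choice.on path_sgrp.
HB.instance Definition _ := isSemigroup.Build path_sgrp pmulA.

Definition pgrade (i : nat) : set path_sgrp :=
  [set x | x = pzero \/ exists2 r, x = Some r & plen r = i].

(* In a step (a, b), the arrow a is traversed forwards if b is true and        *)
(* backwards if b is false.                                                    *)
Definition step := (A * bool)%type.
Definition step_src (s : step) : V := if s.2 then src s.1 else tgt s.1.
Definition step_tgt (s : step) : V := if s.2 then tgt s.1 else src s.1.

Record subquiver := Subquiver {
  sub_vertex : {set V};
  sub_arrow : {set A};
  sub_closed : forall a, a \in sub_arrow ->
    (src a \in sub_vertex) && (tgt a \in sub_vertex) }.

(* w goes once around C. Distinctness of the arrows matters for size w = 2,    *)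
(* where it excludes going back and forth along a single arrow.                *)
Definition cyclic_traversal (C : subquiver) (w : seq step) : Prop :=
  [/\ w != [::],
      cycle (fun s1 s2 => step_tgt s1 == step_src s2) w,
      uniq (map step_src w),
      uniq (map fst w) &
      sub_vertex C = [set:: map step_src w]%SET /\
      sub_arrow C = [set:: map fst w]%SET].

Definition is_cycle (C : subquiver) : Prop := exists w, cyclic_traversal C w.

(* The choice of the traversal only affects which direction is clockwise. *)
Definition symmetric_cycle (C : subquiver) : Prop :=
  forall w, cyclic_traversal C w ->
    count (fun s : step => s.2) w = count (fun s : step => ~~ s.2) w.

Record system := System {
  carrier :> topologicalType;
  carrier_nonempty : [set: carrier] !=set0;
  act : path_sgrp -> carrier -> carrier;
  actM : forall (x y : path_sgrp) (m : carrier),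
    act (x * y)%g m = act x (act y m);
  act_continuous : forall x : path_sgrp, continuous (act x) }.

Definition is_theta (M : system) (th : M) : Prop :=
  [/\ connected_component [set: M] th = [set th],
      isolated [set: M] th &
      forall m : M, act pzero m = th].

(* The objects of P(Q)-TOP^o; theta is determined by theta_unique, so having   *)
(* it as a field adds no structure.                                            *)
Record topo := Topo {
  topo_system :> system;
  topo_full : [set act x m | x in [set: path_sgrp] & m in [set: topo_system]]
              = [set: topo_system];
  theta : topo_system;
  theta_unique : unique (@is_theta topo_system) theta;
  topo_arrow : forall (a : A) (m : topo_system),
    act (Some (trivial_path (src a))) m <> theta ->
    act (Some (arrow_path a)) m <> theta }.

Definition positive_gradation (M : topo) (G : nat -> set M) : Prop :=
  [/\ forall i, G i !=set0,
      [set: M] = \bigcup_i G i,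
      forall i j, [set act x m | x in pgrade i & m in G j] `<=` G (i + j)%N &
      forall i j, i <> j -> G i `&` G j = [set theta M]].

Definition positively_graded (M : topo) : Prop :=
  exists G : nat -> set M, positive_gradation G.

Definition vertex_positively_graded (M : topo) : Prop :=
  exists2 G : nat -> set M, positive_gradation G &
    forall v : V, exists i, range (@act M (Some (trivial_path v))) `<=` G i.

End Quiver.

(* Main.v *)
Require Import Defs.
From mathcomp Require Import all_boot.
From mathcomp Require Import zify boolp.
From mathcomp Require Import classical_sets topology.

(** The existence of an arrow positive function F links all four properties.

    Given F, an object M is vertex positively graded by putting e_v M in degree
    F v: a path of length i from v to w has F w = F v + i, so it sends e_v M
    into the component of degree F v + i, and the sets e_v M pairwise meet only
    in theta because e_v e_w = 0 for v <> w (lemma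
    [arrow_positive_vertex_graded]).

    Conversely, a single object detects F: the discrete space of vertices with
    an added zero, on which a path moves its source to its target.  In a
    positive gradation of it every vertex has exactly one degree, and an arrow
    raises the degree by one (lemma [graded_arrow_positive]).

    Finally, an arrow positive function is a potential for the discrete 1-form
    that is 1 on each arrow.  A potential forces every closed walk in the
    underlying graph to have as many forward as backward steps.  In the other
    direction, a closed walk that is not a simple cycle splits into shorter
    closed walks, so symmetry of simple cycles gives symmetry of all closed
    walks (lemma [closed_walk_balanced]); the signed length of a walk from a
    base vertex then depends on its end only, and it becomes a nonnegative
    potential after adding a large constant (lemma [balanced_arrow_positive]). *)

Set Implicit Arguments.
Unset Strict Implicit.
Unset Printing Implicit Defensive.

Lemma not_uniq_map_split (T U : eqType) (f : T -> U) (w : seq T) :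
  ~~ uniq (map f w) -> exists w1 s w2 t w3,
    w = w1 ++ s :: w2 ++ t :: w3 /\ f s = f t.
Proof.
elim: w => //= s w IH; rewrite negb_and negbK => /orP[/mapP[t tw est]|/IH].
  by case/splitPr: tw => w2 w3; exists [::], s, w2, t, w3.
by move=> [w1 [s1 [w2 [t [w3 [-> e]]]]]]; exists (s :: w1), s1, w2, t, w3.
Qed.

Section Walks.
Variable Q : finQuiver.
Local Notation V := (vertex Q).
Local Notation A := (arrow Q).
Implicit Types (F : V -> nat) (x y z : V) (w : seq (step Q)) (s t : step Q).

(** * Walks in the underlying graph *)

Fixpoint stepwalk x w y : bool :=
  if w is s :: w' then (step_src s == x) && stepwalk (step_tgt s) w' y
  else x == y.

Definition forwards w := count (fun s : step Q => s.2) w.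
Definition backwards w := count (fun s : step Q => ~~ s.2) w.
Definition balanced w := forwards w = backwards w.

Lemma stepwalk_cat x w1 w2 y :
  stepwalk x (w1 ++ w2) y <->
  exists2 z, stepwalk x w1 z & stepwalk z w2 y.
Proof.
elim: w1 x => [|s w1 IH] x /=.
  by split=> [h|[z /eqP->]//]; exists x.
split=> [/andP[-> /IH[z h1 h2]]|[z /andP[-> h1] h2]]; first by exists z.
by apply/IH; exists z.
Qed.

Lemma stepwalk_consP x s w y :
  stepwalk x (s :: w) y <-> step_src s = x /\ stepwalk (step_tgt s) w y.
Proof. by split=> /= [/andP[/eqP->]|[-> ->]] //; rewrite eqxx. Qed.

Lemma cycle_stepwalk s w :
  cycle (fun s1 s2 => step_tgt s1 == step_src s2) (s :: w)
  = stepwalk (step_src s) (s :: w) (step_src s).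
Proof.
have walkE r v : path (fun s1 s2 => step_tgt s1 == step_src s2) r (rcons w v)
    = stepwalk (step_tgt r) w (step_src v).
  elim: w r => [|a w IH] r /=; first by rewrite andbT.
  by rewrite IH eq_sym.
by rewrite /= walkE eqxx.
Qed.

Lemma stepwalk_tgt x w y s : stepwalk x w y -> s \in w ->
  (step_tgt s == y) || (step_tgt s \in map (@step_src Q) w).
Proof.
elim: w x => //= t w IH x /andP[_ wy]; rewrite !inE => /orP[/eqP->|sw].
  case: w wy {IH} => /= [->//|r w /andP[/eqP-> _]].
  by rewrite !inE eqxx !orbT.
by case/orP: (IH _ wy sw) => ->; rewrite ?orbT.
Qed.

Lemma stepwalk_connect x y : connected_quiver Q -> exists w, stepwalk x w y.
Proof.
move=> /(_ x y)/connectP[p]; elim: p x => [|z p IH] x /=.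
  by move=> _ ->; exists [::] => /=.
move=> /andP[/existsP[a xz] pp] /(IH _ pp)[w wy].
case/orP: xz => /andP[ax az].
  by exists ((a, true) :: w); rewrite /= /step_src /step_tgt /= ax (eqP az).
by exists ((a, false) :: w); rewrite /= /step_src /step_tgt /= az (eqP ax).
Qed.

(** * Symmetric cycles and potentials *)

Lemma arrow_positive_stepwalk F x w y : arrow_positive F -> stepwalk x w y ->
  F y + backwards w = F x + forwards w.
Proof.
rewrite /forwards /backwards => hF.
elim: w x => [|[a b] w IH] x /=; first by move=> /eqP->.
move=> /andP[/eqP<- /IH] {IH}; rewrite /step_src /step_tgt /=.
by case: b => /=; rewrite hF; lia.
Qed.

Lemma arrow_positive_symmetric F : arrow_positive F ->
  forall C : subquiver Q, is_cycle C -> symmetric_cycle C.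
Proof.
move=> hF C _ [|s w] [] // _; rewrite cycle_stepwalk => h _ _ _.
by have := arrow_positive_stepwalk hF h; rewrite /forwards /backwards; lia.
Qed.

(** The target of a step of a closed walk is the source of the cyclically next
    one, so the sources of the steps already comprise both ends of each arrow
    met, and with these arrows they form a subquiver. *)
Lemma closed_walk_traversal x w : w != [::] -> stepwalk x w x ->
    uniq (map (@step_src Q) w) -> uniq (map fst w) ->
  exists C : subquiver Q, cyclic_traversal C w.
Proof.
move=> w0 wx us ua.
have xw : x \in map (@step_src Q) w.
  by case: w w0 wx {us ua} => //= s w _ /andP[/eqP<- _]; rewrite inE eqxx.
have closedw a : a \in [set:: map fst w]%SET ->
    (src a \in [set:: map (@step_src Q) w]%SET) &&
    (tgt a \in [set:: map (@step_src Q) w]%SET).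
  rewrite !inE => /mapP[s sw ->].
  have hs : step_src s \in map (@step_src Q) w by apply: map_f.
  have ht : step_tgt s \in map (@step_src Q) w.
    by case/orP: (stepwalk_tgt wx sw) => // /eqP->.
  by move: hs ht; rewrite /step_src /step_tgt; case: s.2 => -> ->.
exists (Subquiver closedw); split=> //.
by case: w w0 wx {us ua xw closedw} => // s w _ /[dup] wx /andP[/eqP sx _];
  rewrite cycle_stepwalk sx.
Qed.

(** Induction on the length.  If an arrow or a vertex is repeated, the walk is
    cut at two occurrences into shorter closed walks.  When an arrow is
    traversed once in each direction, removing both steps leaves two closed
    walks, and the removed steps cancel; otherwise two steps have the same
    source, and the walk is a closed walk inserted into another one. *)
Lemma closed_walk_balanced x w :
    (forall C : subquiver Q, is_cycle C -> symmetric_cycle C) ->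
  stepwalk x w x -> balanced w.
Proof.
move=> hC; have [n] := ubnP (size w); elim: n => // n IH in x w *.
rewrite ltnS => wn wx.
(* A closed walk u is taken out; what remains is closed and also shorter. *)
have cut y w1 u w3 : stepwalk x w1 y -> stepwalk y u y -> stepwalk y w3 x ->
    size u < n -> size (w1 ++ w3) < n -> balanced (w1 ++ u ++ w3).
  move=> h1 hu h3 un vn; have := IH _ _ un hu.
  have := IH x (w1 ++ w3) vn; rewrite stepwalk_cat => /(_ (ex_intro2 _ _ y h1 h3)).
  by rewrite /balanced /forwards /backwards !count_cat; lia.
have cut_src w1 s w2 t w3 : w = w1 ++ s :: w2 ++ t :: w3 ->
    step_src s = step_src t -> balanced w.
  move=> ew st; move: wx wn.
  rewrite ew -cat_cons => /stepwalk_cat[y h1 /stepwalk_cat[z h2 h3]] wn.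
  have [sy _] := (stepwalk_consP _ _ _ _).1 h2.
  have [tz _] := (stepwalk_consP _ _ _ _).1 h3.
  have zy : z = y by rewrite -tz -st.
  by rewrite zy in h2 h3; apply: (cut y) => //;
    move: wn; rewrite !size_cat /= ?size_cat /=; lia.
case: (boolP (uniq (map fst w))) => [ua|/not_uniq_map_split]; last first.
  move=> [w1 [[a b] [w2 [[a' c] [w3 [ew /= aa']]]]]]; rewrite -{a'}aa' in ew.
  case: (eqVneq b c) => [bc|bc]; first by apply: cut_src ew _; rewrite bc.
  move: wx wn; rewrite ew /balanced => /stepwalk_cat[y h1].
  move=> /stepwalk_consP[ey /stepwalk_cat[z h2 /stepwalk_consP[ez h3]]] wn.
  have zE : step_tgt (a, b) = z.
    by rewrite -ez; move: bc; case: (b); case: (c).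
  have yE : step_tgt (a, c) = y.
    by rewrite -ey; move: bc; case: (b); case: (c).
  rewrite zE in h2; rewrite yE in h3.
  have hin : balanced w2.
    by apply: (IH z) h2; move: wn; rewrite !size_cat /= size_cat /=; lia.
  have hout : balanced (w1 ++ w3).
    apply: (IH x); last by apply/stepwalk_cat; exists y.
    by move: wn; rewrite !size_cat /= size_cat /=; lia.
  move: hin hout bc; rewrite /balanced /forwards /backwards.
  rewrite !count_cat /= !count_cat /=; case: (b); case: (c) => //=; lia.
case: (boolP (uniq (map (@step_src Q) w))) => [us|/not_uniq_map_split]; last first.
  by move=> [w1 [s [w2 [t [w3 [ew st]]]]]]; apply: cut_src ew st.
have [->|w0] := eqVneq w [::]; first by [].
have [C tC] := closed_walk_traversal w0 wx us ua.
by apply: hC (tC); exists w.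
Qed.

(** The potential of v is the signed length of a walk from a base vertex to v;
    a walk back to the base vertex compares the potentials at both ends of an
    arrow.  The constant added bounds the backward steps of all the chosen
    walks, so that the truncated subtraction is exact. *)
Lemma balanced_arrow_positive : connected_quiver Q ->
    (forall x w, stepwalk x w x -> balanced w) ->
  exists F : V -> nat, arrow_positive F.
Proof.
move=> hQ hbal; case: (pickP V) => [o _|V0]; last first.
  by exists (fun=> 0) => a; have := V0 (src a).
have out v : {w | stepwalk o w v} by apply/sigW/stepwalk_connect.
pose N := \sum_v backwards (sval (out v)).
have leN v : backwards (sval (out v)) <= N.
  by rewrite /N (bigD1 v) //= leq_addr.
exists (fun v => forwards (sval (out v)) + N - backwards (sval (out v))) => a.
move: (leN (src a)) (leN (tgt a)).
case: (out (src a)) (out (tgt a)) => [p hp] [q hq] /=.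
have [r hr] := stepwalk_connect (tgt a) o hQ.
have : balanced (q ++ r) by apply: (hbal o); apply/stepwalk_cat; exists (tgt a).
have : balanced (p ++ (a, true) :: r).
  apply: (hbal o); apply/stepwalk_cat; exists (src a) => //.
  exact/stepwalk_consP.
by rewrite /balanced /forwards /backwards !count_cat /=; lia.
Qed.

End Walks.

(** * Arrow positive functions and gradations *)

Section Gradations.
Variable Q : finQuiver.
Local Notation V := (vertex Q).
Local Open Scope classical_set_scope.

Lemma pmul_trivialr (r : qpath Q) (v : V) : psrc r <> v ->
  pmul (Some r) (Some (trivial_path v)) = pzero Q.
Proof. by move=> rv; rewrite /=; case: eqP. Qed.

Lemma pmul_trivial_tgt (r : qpath Q) :
  pmul (Some (trivial_path (ptgt r))) (Some r) = Some r.
Proof.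
rewrite /=; case: eqP => [e|//]; congr Some; apply: val_inj => /=.
by rewrite cats0 /psrc /parr -surjective_pairing.
Qed.

Lemma pmul_trivial_idem (v : V) :
  pmul (Some (trivial_path v)) (Some (trivial_path v)) = Some (trivial_path v).
Proof. exact: (pmul_trivial_tgt (trivial_path v)). Qed.

Lemma act_pmul (M : system Q) (x y : path_sgrp Q) (m : M) :
  act (pmul x y) m = act x (act y m).
Proof. exact: actM. Qed.

Lemma arrow_positive_ptgt (F : V -> nat) (r : qpath Q) : arrow_positive F ->
  F (ptgt r) = plen r + F (psrc r).
Proof.
move=> hF; case: r => [[v l] /= hl]; rewrite /ptgt /plen /psrc /parr /=.
rewrite /walk_end; elim: l v hl => //= a l IH v /andP[/eqP<- /IH->].
by rewrite hF addSnnS addn1.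
Qed.

(** The degree i component is the union of the e_v M with F v = i.  Theta is
    added to it because F need not take the value i. *)
Lemma arrow_positive_vertex_graded (F : V -> nat) : arrow_positive F ->
  forall M : topo Q, vertex_positively_graded M.
Proof.
move=> hF M; have [[_ _ th0] _] := theta_unique M.
pose e v := @act Q M (Some (trivial_path v)).
have act_theta x : act x (theta M) = theta M.
  by rewrite -{1}(th0 (theta M)) -act_pmul; case: x => [r|]; apply: th0.
have act_tgt r m : act (Some r) m = e (ptgt r) (act (Some r) m).
  by rewrite /e -act_pmul pmul_trivial_tgt.
pose G i : set M := [set m | m = theta M \/ exists2 v, F v = i & range (e v) m].
exists G; last by move=> v; exists (F v) => m vm; right; exists v.
split=> [i||i j|i j ij].
- by exists (theta M); left.
- rewrite -topo_full; apply/seteqP; split=> [_ [[r|] _ [m _ <-]]|m _].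
  + exists (F (ptgt r)) => //; right; exists (ptgt r) => //.
    by rewrite act_tgt; eexists.
  + by exists 0 => //; left; apply: th0.
  + by rewrite topo_full.
- move=> _ [x [->|[r -> ri]] [m Gm <-]]; first by left; apply: th0.
  case: Gm => [->|[v Fv [m' _ <-]]]; first by left; apply: act_theta.
  case: (eqVneq (psrc r) v) => [rv|/eqP rv]; last first.
    by left; rewrite /e -act_pmul pmul_trivialr // th0.
  right; exists (ptgt r); first by rewrite arrow_positive_ptgt // ri rv Fv.
  by rewrite act_tgt; eexists.
- apply/seteqP; split=> [m [[//|[v Fv [n _ nm]]] [//|[w Fw [n' _ nm']]]]|m ->].
    (* e_v fixes m, so m lies in e_v (e_w M), which is 0 M. *)
    have vw : v <> w by move=> vw; apply: ij; rewrite -Fv -Fw vw.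
    have em : e v m = m by rewrite -nm /e -act_pmul pmul_trivial_idem.
    by rewrite /= -em -nm' /e -act_pmul pmul_trivialr // th0.
  by split; left.
Qed.

(** None plays theta.  The discrete topology makes its singleton an isolated
    connected component and makes every action map continuous. *)
Definition vertex_zero := discrete_topology (option V).

Definition vertex_act (x : path_sgrp Q) (m : vertex_zero) : vertex_zero :=
  if x is Some r then if m == Some (psrc r) then Some (ptgt r) else None
  else None.

Lemma vertex_actM (x y : path_sgrp Q) m :
  vertex_act (pmul x y) m = vertex_act x (vertex_act y m).
Proof.
case: x y => [r|] [r'|] //=; case: eqP => [e|ne] /=.
  case: (m == _) => //=; case: eqP => [_|]; last by rewrite -e; case.
  by rewrite /ptgt walk_end_cat -/(ptgt r') -e.
by case: (m == _) => //=; case: eqP => // -[/esym/ne].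
Qed.

Lemma vertex_act_continuous (x : path_sgrp Q) : continuous (vertex_act x).
Proof. by move=> m A; rewrite !nbhs_principalE => Am _ ->; apply: Am. Qed.

Lemma vertex_zero_nonempty : [set: vertex_zero] !=set0.
Proof. by exists None. Qed.

Definition vertex_system : system Q :=
  System vertex_zero_nonempty vertex_actM vertex_act_continuous.

Lemma vertex_full :
  [set act x m | x in [set: path_sgrp Q] & m in [set: vertex_system]]
  = [set: vertex_system].
Proof.
apply/seteqP; split=> // -[v|] _; last by exists (pzero Q) => //; exists None.
exists (Some (trivial_path v)) => //; exists (Some v) => //=.
by rewrite /vertex_act eqxx.
Qed.

Lemma vertex_theta : unique (@is_theta Q vertex_system) None.
Proof.
split=> [|th [_ _ /(_ None)] //]; split=> //.
  exact: (zero_dimension_totally_disconnected discrete_zero_dimension).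
split; first exact/mem_set.
exists [set None]; last by rewrite setIT.
by rewrite nbhs_principalE; apply/principal_filterP.
Qed.

Lemma vertex_arrow (a : arrow Q) (m : vertex_system) :
  act (Some (trivial_path (src a))) m <> None ->
  act (Some (arrow_path a)) m <> None.
Proof. by rewrite /act /=; case: (m == _). Qed.

Definition vertex_topo : topo Q := Topo vertex_full vertex_theta vertex_arrow.

(** A vertex differs from theta, so disjointness away from theta makes its
    degree unique; the arrow a, of degree 1, sends src a to tgt a. *)
Lemma graded_arrow_positive : positively_graded vertex_topo ->
  exists F : V -> nat, arrow_positive F.
Proof.
move=> [G [_ Gcover Gmul Gdisj]].
have deg v : {i | G i (Some v)}.
  apply/cid; have : [set: vertex_topo] (Some v) by [].
  by rewrite Gcover => -[i _ ?]; exists i.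
exists (fun v => sval (deg v)) => a.
case: (deg (src a)) (deg (tgt a)) => [i hi] [j hj] /=.
have h : G (1 + i) (Some (tgt a)).
  apply: Gmul; exists (Some (arrow_path a)); first by right; eexists.
  by exists (Some (src a)) => //; rewrite /act /= eqxx.
rewrite addnC; apply/eqP/negPn/negP => /eqP /Gdisj ji.
by have : (G j `&` G (1 + i)) (Some (tgt a)) by []; rewrite ji.
Qed.

End Gradations.

Theorem theorem3p6 (Q : finQuiver) (hQ : connected_quiver Q) :
  [<-> (* (i) *) forall M : topo Q, positively_graded M;
       (* (ii) *) forall C : subquiver Q, is_cycle C -> symmetric_cycle C;
       (* (iii) *) exists F : vertex Q -> nat, arrow_positive F;
       (* (iv) *) forall M : topo Q, vertex_positively_graded M].
Proof.
tfae=> [hgr|hC|[F hF]|hgr M].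
- have [F hF] := graded_arrow_positive (hgr (vertex_topo Q)).
  exact: arrow_positive_symmetric hF.
- by apply: balanced_arrow_positive => // x w; apply: closed_walk_balanced.
- exact: arrow_positive_vertex_graded hF.
- by have [G hG _] := hgr M; exists G.
Qed.
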